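(* Let $T\in\,]0,+\infty]$, let $P\in\mathbb R^{n\times n}$ be symmetric positive definite, let $f$ and $g_1,\dots,g_k$ be smooth vector fields on $\mathbb R^n$, $G=(g_1,\dots,g_k)$, $x_0\in\mathbb R^n$ (and, if $T<+\infty$ and an endpoint condition is imposed, $x_T\in\mathbb R^n$). Let $\rho:[0,T]\times\mathbb R^k\to[0,+\infty[$ be a nonnegative Borel function, and let $\mathcal U_\rho$, $J_0^T$, $J_\varepsilon^T$ be as defined in the context. Then $$\lim_{\varepsilon\to0^+}\ \inf_{u\in\mathcal U_\rho}J^T_\varepsilon(u)=\inf_{u\in\mathcal U_\rho}J_0^T(u).$$ This holds both for the problem without endpoint condition and, when $T<+\infty$, for the problem with endpoint condition $x(T)=x_T$.
   Context: Control system: $\dot x=f(x)+G(x)u$, $x(0)=x_0$, with trajectory $x_u$ corresponding to the control $u$. If $T=+\infty$, $[0,T]$ means $[0,+\infty[$. $\mathcal U_\rho=\{u:[0,T]\to\mathbb R^k \text{ measurable}: \int_0^T\rho(t,u(t))\,dt<+\infty\}$. Cost functionals: $J_0^T(u)=\int_0^T x_u(t)'Px_u(t)\,dt$ and, for $\varepsilon>0$, $J_\varepsilon^T(u)=\int_0^T \big(x_u(t)'Px_u(t)+\varepsilon\rho(t,u(t))\big)\,dt$; by convention these equal $+\infty$ for any $u\in\mathcal U_\rho$ for which the control system has no solution on $[0,T[$. When $T<+\infty$, an endpoint condition $x(T)=x_T$ may be added to the problem; in that case the infima are taken over those $u\in\mathcal U_\rho$ whose trajectory satisfies $x_u(T)=x_T$.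 *)

(* Defs.v *)
From HB Require Import structures.
From mathcomp Require Import all_boot all_order all_algebra.
From mathcomp Require Import all_classical all_reals all_analysis.

Set Implicit Arguments.
Unset Strict Implicit.
Unset Printing Implicit Defensive.

Import Order.TTheory GRing.Theory Num.Theory.
Import numFieldNormedType.Exports.

Local Open Scope classical_set_scope.
Local Open Scope ring_scope.

(* The real line with the sigma-algebra of Lebesgue (not only Borel) measurable
   sets, which is the domain of [completed_lebesgue_measure]. Composing a Borel
   function with a Lebesgue measurable one does not leave this class. *)
Definition lebesgueR (R : realType) :=
  caratheodory_type (mu_ext (@wlength R idfun)).

Notation borel V := (g_sigma_algebraType (@open V)).

(* [0, T] is [0, +oo[ when T = +oo. *)
Definition time_cc (R : realType) (T : \bar R) : set R :=
  [set t | 0 <= t /\ (t%:E <= T)%E].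

Definition time_co (R : realType) (T : \bar R) : set R :=
  [set t | 0 <= t /\ (t%:E < T)%E].

(* In finite dimension, C^(m+1) means differentiable with all directional
   derivatives of class C^m. *)
Fixpoint class_C (R : realType) (n p m : nat) (h : 'cV[R]_n -> 'cV[R]_p) :
    Prop :=
  if m is m'.+1 then
    (forall x, differentiable h x) /\
    (forall v, class_C m' (fun x => 'D_v h x))
  else continuous h.

Definition smooth (R : realType) (n p : nat) (h : 'cV[R]_n -> 'cV[R]_p) :
    Prop :=
  forall m, class_C m h.

Definition quad (R : realType) (n : nat) (P : 'M[R]_n) (x : 'cV[R]_n) : R :=
  (x^T *m P *m x) 0 0.

Definition sym_posdef (R : realType) (n : nat) (P : 'M[R]_n) : Prop :=
  P^T = P /\ forall x : 'cV[R]_n, x != 0 -> 0 < quad P x.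

Definition abs_continuous (R : realType) (n : nat) (x : R -> 'cV[R]_n)
    (a b : R) : Prop :=
  forall e : R, 0 < e -> exists2 d : R, 0 < d &
    forall (m : nat) (l r : 'I_m -> R),
      (forall i, [/\ a <= l i, l i <= r i & r i <= b]) ->
      trivIset [set: 'I_m] (fun i => `]l i, r i[%classic) ->
      \sum_(i < m) (r i - l i) < d ->
      \sum_(i < m) `|x (r i) - x (l i)| < e.

Section control_problem.
Variables (R : realType) (n k : nat) (T : \bar R).
Variables (f : 'cV[R]_n -> 'cV[R]_n) (g : 'I_k -> 'cV[R]_n -> 'cV[R]_n).
Variables (x0 : 'cV[R]_n) (P : 'M[R]_n) (rho : R * 'cV[R]_k -> R).

Definition Gmx (x : 'cV[R]_n) : 'M[R]_(n, k) := \matrix_(i, j) g j x i 0.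

(* Caratheodory solution on [0, T[: locally absolutely continuous, and
   satisfying the differential equation almost everywhere. *)
Definition is_trajectory (u : R -> 'cV[R]_k) (x : R -> 'cV[R]_n) : Prop :=
  [/\ x 0 = x0,
      forall b, time_co T b -> abs_continuous x 0 b &
      {ae @completed_lebesgue_measure R, forall t, time_co T t ->
        is_derive (t : R) (1 : R) x (f (x t) + Gmx (x t) *m u t)}].

Definition has_trajectory (u : R -> 'cV[R]_k) : Prop :=
  exists x, is_trajectory u x.

(* A choice u |-> x_u of a trajectory for every control that has one. The
   trajectory is unique on [0, T[ when u is locally integrable there, but a
   control that is merely measurable may have several. *)
Definition trajectory_map (xu : (R -> 'cV[R]_k) -> R -> 'cV[R]_n) : Prop :=
  forall u, has_trajectory u -> is_trajectory u (xu u).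

Definition controls : set (R -> 'cV[R]_k) :=
  [set u | @measurable_fun _ _ (lebesgueR R) (borel 'cV[R]_k) (time_cc T) u /\
    (\int[@completed_lebesgue_measure R]_(t in time_cc T)
       (rho (t, u t))%:E < +oo)%E].

(* The trajectory lives on [0, T[, so its value at T is its limit there. *)
Definition controls_to (xu : (R -> 'cV[R]_k) -> R -> 'cV[R]_n) (Tf : R)
    (xT : 'cV[R]_n) : set (R -> 'cV[R]_k) :=
  [set u | [/\ controls u, has_trajectory u &
    xu u t @[t --> Tf^'-] --> xT]].

Definition J0 (xu : (R -> 'cV[R]_k) -> R -> 'cV[R]_n) (u : R -> 'cV[R]_k) :
    \bar R :=
  if `[< has_trajectory u >] then
    (\int[@completed_lebesgue_measure R]_(t in time_cc T)
       (quad P (xu u t))%:E)%E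
  else +oo%E.

Definition J (xu : (R -> 'cV[R]_k) -> R -> 'cV[R]_n) (eps : R)
    (u : R -> 'cV[R]_k) : \bar R :=
  if `[< has_trajectory u >] then
    (\int[@completed_lebesgue_measure R]_(t in time_cc T)
       (quad P (xu u t) + eps * rho (t, u t))%:E)%E
  else +oo%E.

End control_problem.

(* Main.v *)
(* For each control u with a trajectory, J_eps(u) = J_0(u) + eps C(u) with
   C(u) = int rho(t, u(t)) dt finite. Hence eps |-> inf_u J_eps(u) is
   nondecreasing, so its right limit at 0 is an infimum over eps > 0, which can
   be exchanged with the infimum over u. The analytic point is the additivity of
   the integral: t |-> x_u(t) is continuous on [0, T[, and t |-> rho(t, u(t)) is
   Lebesgue measurable because the Borel sets of R * R^k are generated by open
   rectangles. *)
Require Import Defs.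
From mathcomp Require Import all_boot all_order all_algebra.
From mathcomp Require Import all_classical all_reals all_analysis.
From mathcomp Require Import measurable_realfun.

Set Implicit Arguments.
Unset Strict Implicit.
Unset Printing Implicit Defensive.

Import Order.TTheory GRing.Theory Num.Theory.
Import numFieldNormedType.Exports.

Local Open Scope classical_set_scope.
Local Open Scope ring_scope.

(** * Infima of penalized extended-real functionals *)

(** [F0] may take infinite values and [A] may be empty. Only [C u] must be finite, so that for each
    fixed [u] a small enough [e] makes the penalty negligible; no uniformity in [u] is required. *)
Lemma cvg_ereal_inf_penalty (R : realType) (U : Type) (A : set U)
    (F : R -> U -> \bar R) (F0 C : U -> \bar R) :
  (forall e u, A u -> 0 < e -> F e u = (F0 u + e%:E * C u)%E) ->
  (forall u, A u -> (0 <= C u < +oo)%E) ->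
  ereal_inf [set F e u | u in A] @[e --> 0^'+] --> ereal_inf [set F0 u | u in A].
Proof.
move=> FE C0.
have Cge u : A u -> (0 <= C u)%E by move=> /C0 /andP[].
(* The half-line is open at 0: the formula for [F e] is available for positive [e] only. *)
pose I := Interval (BRight 0) (+oo%O : itv_bound R).
suff -> : ereal_inf [set F0 u | u in A] =
    ereal_inf ((fun e => ereal_inf [set F e u | u in A]) @` [set` I]).
  apply: nondecreasing_at_right_cvge => // a b.
  rewrite !in_itv/= !andbT => a0 b0 ab.
  apply: le_ereal_inf_tmp => _ [u Au <-]; apply: ge_ereal_inf.
  exists (F a u); first by exists u.
  by rewrite !FE// leeD2l// lee_wpmul2r ?lee_fin ?Cge.
apply/eqP; rewrite eq_le; apply/andP; split.
  apply: le_ereal_inf_tmp => _ [e + <-]; rewrite /= in_itv/= andbT => e0.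
  apply: le_ereal_inf_tmp => _ [u Au <-]; apply: ge_ereal_inf.
  exists (F0 u); first by exists u.
  by rewrite FE// leeDl// mule_ge0 ?Cge// lee_fin ltW.
apply: le_ereal_inf_tmp => _ [u Au <-].
have /andP[Cu0 Cuy] := C0 u Au.
have Cf : C u \is a fin_num by rewrite ge0_fin_numE.
have Cu0' : 0 <= fine (C u) by rewrite fine_ge0.
apply/lee_addgt0Pr => d d0.
(* This choice gives [e * C u <= d]; the [+ 1] keeps the denominator positive when [C u]
   vanishes. *)
pose e := d / (fine (C u) + 1).
have e0 : 0 < e by rewrite divr_gt0// ltr_wpDl.
apply: ge_ereal_inf; exists (ereal_inf [set F e u | u in A]).
  by exists e => //; rewrite /= in_itv/= e0.
apply: ge_ereal_inf; exists (F e u); first by exists u.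
rewrite FE// leeD2l// -(fineK Cf) -EFinM lee_fin.
rewrite /e mulrAC ler_pdivrMr ?ltr_wpDl//.
by rewrite ler_pM2l// lerDl.
Qed.

(** * Lebesgue measurability of time domains and of graphs of controls *)

Lemma measurable_lebesgueR (R : realType) (A : set R) :
  measurable (A : set (measurableTypeR R)) -> measurable (A : set (lebesgueR R)).
Proof. exact: sub_caratheodory. Qed.

Lemma time_cc_closed (R : realType) (T : \bar R) : closed (time_cc T).
Proof.
case: T => [r| |].
- rewrite (_ : time_cc _ = `[0, r]%classic); first exact: interval_closed.
  apply/seteqP; split => t; rewrite /time_cc/= in_itv/= lee_fin.
    by move=> [-> ->].
  by move/andP.
- rewrite (_ : time_cc _ = `[0, +oo[%classic); first exact: interval_closed.
  apply/seteqP; split => t; rewrite /time_cc/= in_itv/= leey andbT.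
    by move=> [].
  by [].
- rewrite (_ : time_cc _ = set0); first exact: closed0.
  by apply/seteqP; split => t // [_]; rewrite leeNy_eq.
Qed.

Lemma time_co_measurable (R : realType) (T : \bar R) :
  measurable (time_co T : set (measurableTypeR R)).
Proof.
apply: is_interval_measurable => a b [a0 _] [_ bT] c /andP[ac cb].
by split; [exact: le_trans ac|exact: le_lt_trans bT].
Qed.

Lemma measurable_time_cc (R : realType) (T : \bar R) :
  measurable (time_cc T : set (lebesgueR R)).
Proof.
by apply: measurable_lebesgueR; apply: closed_measurable; exact: time_cc_closed.
Qed.

(* Only the real factor needs a countable base: an open set of [R * V] is the
   union over rational [q] of the products of a rational interval with the
   union of all open sets fitting over it. *)
Lemma measurable_fun_pair_borel (R : realType) (V : ptopologicalType)
    (D : set R) (u : R -> V) :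
  @measurable_fun _ _ (lebesgueR R) (borel V) D u ->
  @measurable_fun _ _ (lebesgueR R) (borel (R * V)%type) D (fun t => (t, u t)).
Proof.
move=> mu mD.
apply: (@measurability _ _ (lebesgueR R) (borel (R * V)%type) _ _
  (@open (R * V)%type) _ _ mD) => // _ [W oW <-].
pose O (q : rat * rat) := \bigcup_(B in [set B : set V |
  open B /\ `]ratr q.1, ratr q.2[%classic `*` B `<=` W]) B.
rewrite (_ : D `&` _ = \bigcup_(q : rat * rat)
    (`]ratr q.1, ratr q.2[%classic `&` (D `&` u @^-1` O q))).
  apply: countable_bigcupT_measurable; first exact: countableP.
  move=> q; apply: measurableI.
    by apply: measurable_lebesgueR; exact: measurable_itv.
  by apply: mu mD _ _; apply: sub_sigma_algebra; apply: bigcup_open => B [].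
apply/seteqP; split => t /=.
  move=> [Dt Wt]; have /open_nbhs_nbhs : open_nbhs (t, u t) W by split.
  move=> [[A B] /= [/nbhs_ballP[e /= e0 eA]]].
  rewrite nbhsE => -[B' [oB' B'u] B'B] ABW.
  (* Rational endpoints on either side of [t], both within distance [e], so that the interval
     contains [t] and stays in the ball. *)
  have [p] : exists q, ratr q \in `]t - e, t[.
    by apply: rat_in_itvoo; rewrite ltrBlDr ltrDl.
  rewrite in_itv/= => /andP[tp pt].
  have [q] : exists q, ratr q \in `]t, t + e[.
    by apply: rat_in_itvoo; rewrite ltrDl.
  rewrite in_itv/= => /andP[tq qt].
  exists (p, q) => //; split; first by rewrite /= in_itv/= pt tq.
  split => //; exists B' => //; split => // -[s v] /= [].
  rewrite in_itv/= => /andP[ps sq] B'v; apply: ABW; split => /=; last exact: B'B.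
  by apply: eA; rewrite /ball/= ltr_distlC (lt_trans tp ps) (lt_trans sq qt).
by move=> [q _ [qt [Dt [B [_ BW] But]]]]; split => //; exact: BW.
Qed.

(** * Continuity of trajectories and measurability of the state cost *)

(** Absolute continuity applied to a family of one interval. Its endpoints must be ordered, hence
    the reduction to [s <= t]. *)
Lemma abs_continuous_dist (R : realType) (n : nat) (x : R -> 'cV[R]_n) (a b : R) :
  abs_continuous x a b -> forall e, 0 < e -> exists2 d, 0 < d &
    forall s t, a <= s <= b -> a <= t <= b -> `|s - t| < d -> `|x s - x t| < e.
Proof.
move=> acx e /acx[d d0 xd]; exists d => //.
have le_case s t : a <= s <= b -> a <= t <= b -> s <= t -> `|s - t| < d ->
    `|x s - x t| < e.
  move=> /andP[a_s sb] /andP[a_t tb] st std.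
  have := xd 1%N (fun=> s) (fun=> t); rewrite !big_ord1 distrC; apply => //.
    by move=> i j _ _ _; rewrite !ord1.
  by rewrite (le_lt_trans (ler_norm _))// distrC.
move=> s t sI tI std; have [st|/ltW ts] := leP s t; first exact: le_case.
by rewrite distrC; apply: le_case => //; rewrite distrC.
Qed.

Lemma time_co_gt (R : realType) (T : \bar R) (t : R) :
  time_co T t -> exists2 b, t < b & time_co T b.
Proof.
move=> [t0 tT]; case: T tT => [r| |//]; rewrite /time_co/=.
  rewrite lte_fin => tr; exists ((t + r) / 2); first by rewrite midf_lt.
  split; last by rewrite lte_fin midf_lt.
  by rewrite (le_trans t0)// ltW// midf_lt.
by move=> _; exists (t + 1); rewrite ?ltrDl ?ltry ?addr_ge0.
Qed.

(** Continuity is local: with [b] strictly between [t] and [T], the interval [[0, b]] is a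
    neighbourhood of [t] relative to [[0, T[], and absolute continuity on it applies. *)
Lemma continuous_locally_abs_continuous (R : realType) (n : nat) (T : \bar R)
    (x : R -> 'cV[R]_n) :
  (forall b, time_co T b -> abs_continuous x 0 b) ->
  {within time_co T, continuous x}.
Proof.
move=> acx; apply/subspace_continuousP => t Tt.
have [b tb Tb] := time_co_gt Tt.
apply/cvgrPdist_lt => e e0.
have [d d0 xd] := abs_continuous_dist (acx _ Tb) e0.
have bt0 : 0 < b - t by rewrite subr_gt0.
near=> s; apply: xd; first by case: Tt => -> _; rewrite ltW.
  have [-> _] : time_co T s by near: s; exact: withinT.
  rewrite ltW//.
  have : `|t - s| < b - t by near: s; apply: cvg_within; exact: nbhsx_ballx.
  by rewrite ltr_distlC subrKC => /andP[].
by near: s; apply: cvg_within; exact: nbhsx_ballx.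
Unshelve. all: by end_near. Qed.

Lemma quad_continuous (R : realType) (n : nat) (P : 'M[R]_n) :
  continuous (quad P).
Proof.
rewrite (_ : quad P = fun x : 'cV[R]_n =>
    \sum_(j < n) (\sum_(i < n) x i 0 * P i j) * x j 0).
  apply: continuous_big => [[a b]|j _ x]; first exact: add_continuous.
  apply: continuousM; last exact: coord_continuous.
  apply: continuous_big => [[a b]|i _ y]; first exact: add_continuous.
  by apply: continuousM; [exact: coord_continuous|exact: cst_continuous].
apply/funext => x; rewrite /quad mxE; apply: eq_bigr => j _.
by rewrite mxE; congr (_ * _); apply: eq_bigr => i _; rewrite mxE.
Qed.

Lemma quad_ge0 (R : realType) (n : nat) (P : 'M[R]_n) (x : 'cV[R]_n) :
  sym_posdef P -> 0 <= quad P x.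
Proof.
move=> [_ P0]; have [->|/P0/ltW//] := eqVneq x 0.
by rewrite /quad trmx0 !mul0mx mxE.
Qed.

(** The integral runs over [time_cc T], but a trajectory is controlled on [[0, T[] only. Continuity
    settles [[0, T[]; the value at a finite [T] is arbitrary and adds at most one point to a
    preimage. *)
Lemma measurable_quad_trajectory (R : realType) (n k : nat) (T : \bar R)
    (f : 'cV[R]_n -> 'cV[R]_n) (g : 'I_k -> 'cV[R]_n -> 'cV[R]_n)
    (x0 : 'cV[R]_n) (P : 'M[R]_n) (u : R -> 'cV[R]_k) (x : R -> 'cV[R]_n) :
  is_trajectory T f g x0 u x ->
  @measurable_fun _ _ (lebesgueR R) (measurableTypeR R) (time_cc T)
    (fun t => quad P (x t)).
Proof.
move=> [_ acx _].
have mco : @measurable_fun _ _ (measurableTypeR R) (measurableTypeR R)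
    (time_co T) (fun t => quad P (x t)).
  apply: subspace_continuous_measurable_fun; first exact: time_co_measurable.
  have /subspace_continuousP xc := continuous_locally_abs_continuous acx.
  apply/subspace_continuousP => t Tt.
  by apply: (cvg_comp _ _ (xc t Tt)); exact: quad_continuous.
move=> mcc Y mY.
have -> : time_cc T `&` (fun t => quad P (x t)) @^-1` Y =
    (time_co T `&` (fun t => quad P (x t)) @^-1` Y) `|`
    ([set t | t%:E = T] `&` time_cc T `&` (fun t => quad P (x t)) @^-1` Y).
  apply/seteqP; split => t /=.
    move=> [[t0]]; rewrite le_eqVlt => /orP[/eqP tT|tT] Yt; last by left.
    by right; split => //; split => //; split => //; rewrite tT.
  move=> [[[t0 tT] Yt]|[[_ tT] Yt]]; split => //.
  by split => //; exact: ltW.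
apply: measurableU; apply: measurable_lebesgueR.
  exact: mco (time_co_measurable T) _ mY.
(* The piece at the final time is either empty or a singleton. *)
have [->|] := eqVneq ([set t | t%:E = T] `&` time_cc T `&`
    (fun t => quad P (x t)) @^-1` Y) set0; first exact: measurable0.
move=> /set0P[t [[/= tT Tt] Yt]].
rewrite (_ : _ `&` _ = [set t]); first exact: measurable_set1.
apply/seteqP; split => [s [[/= sT _] _]|s ->]; last by [].
by apply: EFin_inj; rewrite sT tT.
Qed.

(** * Splitting of the penalized cost and the limit of its infimum *)

Section penalized_cost.
Variables (R : realType) (n k : nat) (T : \bar R) (P : 'M[R]_n).
Variables (f : 'cV[R]_n -> 'cV[R]_n) (g : 'I_k -> 'cV[R]_n -> 'cV[R]_n).
Variables (x0 : 'cV[R]_n) (rho : R * 'cV[R]_k -> R).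
Variable xu : (R -> 'cV[R]_k) -> R -> 'cV[R]_n.
Hypothesis P_spd : sym_posdef P.
Hypothesis rho_ge0 : forall t v, time_cc T t -> 0 <= rho (t, v).
Hypothesis rho_borel : @measurable_fun _ _ (borel (R * 'cV[R]_k)%type)
  (measurableTypeR R) (time_cc T `*` setT) rho.
Hypothesis xu_traj : trajectory_map T f g x0 xu.

Lemma measurable_rho_control (u : R -> 'cV[R]_k) : controls T rho u ->
  @measurable_fun _ _ (lebesgueR R) (measurableTypeR R) (time_cc T)
    (fun t => rho (t, u t)).
Proof.
move=> [mu _] mT Y mY.
(* Measurability of [rho] is relative to this domain, so the domain itself must be Borel; it is
   closed, as the preimage of [time_cc T] under the first projection. *)
have mD : measurable (time_cc T `*` setT : set (borel (R * 'cV[R]_k)%type)).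
  rewrite -(setCK (time_cc T `*` setT)); apply: measurableC.
  apply: sub_sigma_algebra; apply: closed_openC.
  rewrite (_ : _ `*` _ = fst @^-1` time_cc T).
    apply: preimage_closed; last exact: time_cc_closed.
    by move=> z _; exact: cvg_fst.
  by apply/seteqP; split => -[t v] //= [].
have := measurable_fun_pair_borel mu mT (rho_borel mD mY).
congr measurable; apply/seteqP; split => t /=.
  by move=> [Tt [_ Yt]].
by move=> [Tt Yt].
Qed.

(** Both terms of the integrand are nonnegative and measurable, so additivity holds even when [J0]
    is infinite. *)
Lemma JE (e : R) (u : R -> 'cV[R]_k) : controls T rho u -> 0 < e ->
  J T f g x0 P rho xu e u = (J0 T f g x0 P xu u +
    e%:E * \int[@completed_lebesgue_measure R]_(t in time_cc T)
      (rho (t, u t))%:E)%E.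
Proof.
move=> Uu e0; rewrite /J /J0; case: asboolP => [hu|_]; last first.
  (* Without a trajectory both sides are [+oo], since the penalty is nonnegative and hence not
     [-oo]. *)
  rewrite addye// gt_eqF// (lt_le_trans (ltNyr 0))// mule_ge0//.
    by rewrite lee_fin ltW.
  by apply: integral_ge0 => t Tt; rewrite lee_fin rho_ge0.
have mq := measurable_quad_trajectory P (xu_traj hu).
have mr := measurable_rho_control Uu.
under eq_integral do rewrite EFinD EFinM.
rewrite ge0_integralD//=.
- rewrite ge0_integralZl_EFin//; last exact: ltW.
  + exact: measurable_time_cc.
  + by move=> t Tt; rewrite lee_fin rho_ge0.
  + exact/measurable_EFinP.
- exact: measurable_time_cc.
- by move=> t _; rewrite lee_fin quad_ge0.
- exact/measurable_EFinP.
- by move=> t Tt; rewrite mule_ge0// lee_fin ?rho_ge0// ltW.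
- by apply: measurable_funeM; exact/measurable_EFinP.
Qed.

(** Stated for any set of admissible controls, so that it covers the problems with and without
    endpoint condition, including the case where no control reaches the endpoint. *)
Lemma cvg_inf_J (A : set (R -> 'cV[R]_k)) : A `<=` controls T rho ->
  ereal_inf [set J T f g x0 P rho xu e u | u in A] @[e --> 0^'+] -->
  ereal_inf [set J0 T f g x0 P xu u | u in A].
Proof.
move=> AU; apply: cvg_ereal_inf_penalty.
  by move=> e u /AU Uu e0; exact: JE.
move=> u /AU[_ ->]; rewrite andbT.
by apply: integral_ge0 => t Tt; rewrite lee_fin rho_ge0.
Qed.

End penalized_cost.

Theorem theorem2p1 (R : realType) (n k : nat) (T : \bar R) (P : 'M[R]_n)
    (f : 'cV[R]_n -> 'cV[R]_n) (g : 'I_k -> 'cV[R]_n -> 'cV[R]_n)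
    (x0 : 'cV[R]_n) (rho : R * 'cV[R]_k -> R)
    (xu : (R -> 'cV[R]_k) -> R -> 'cV[R]_n)
    (T_gt0 : (0 < T)%E)
    (P_spd : sym_posdef P)
    (f_smooth : smooth f)
    (g_smooth : forall j, smooth (g j))
    (rho_ge0 : forall t v, time_cc T t -> 0 <= rho (t, v))
    (rho_borel : @measurable_fun _ _ (borel (R * 'cV[R]_k)%type)
       (measurableTypeR R) (time_cc T `*` setT) rho)
    (xu_traj : trajectory_map T f g x0 xu) :
  ereal_inf [set J T f g x0 P rho xu eps u | u in controls T rho]
      @[eps --> 0^'+]
    --> ereal_inf [set J0 T f g x0 P xu u | u in controls T rho]
  /\
  forall (Tf : R) (xT : 'cV[R]_n), T = Tf%:E ->
    ereal_inf [set J T f g x0 P rho xu eps u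
                | u in controls_to T f g x0 rho xu Tf xT]
        @[eps --> 0^'+]
      --> ereal_inf [set J0 T f g x0 P xu u
                      | u in controls_to T f g x0 rho xu Tf xT].
Proof.
split; first exact: cvg_inf_J.
by move=> Tf xT _; apply: cvg_inf_J => // u [].
Qed.
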